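(* Suppose $I$ is a set, $(A_i)_{i\in I}$ a family of groups, $C$ a group, $h:A=\prod_{i\in I} A_i\to C$ a group homomorphism, and $\kappa$ an uncountable cardinal. Then the following conditions are equivalent: (a) For every partition of $I$ into $<\kappa$ subsets $J_s$ ($s\in S$), there exist finitely many indices $s_0,\dots,s_{n-1}\in S$ such that $\prod_{i\in I-(J_{s_0}\cup\dots\cup J_{s_{n-1}})}A_i\subseteq\ker(h)$. (b) The homomorphism $h$ factors as $A\to A/\mathcal{U}_0\times\dots\times A/\mathcal{U}_{n-1}\to C$ (where the first arrow is the product of the quotient maps) for some finite family of $\kappa$-complete ultrafilters $\mathcal{U}_0,\dots,\mathcal{U}_{n-1}$ on $I$. Hence, when these conditions hold, if $\mathrm{card}(I)$ is less than every measurable cardinal $\geq\kappa$ (in particular, if no such cardinals exist), then $h$ factors through the projection of $A$ to the product of finitely many of the $A_i$. Moreover, when these conditions hold, the filter $$\mathcal{F}=\{J\subseteq I\mid \textstyle\prod_{i\in I-J}A_i\subseteq\ker(h)\}$$ is the intersection of the least family of $\kappa$-complete ultrafilters as in (b).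
   Context: Groups are not assumed abelian. For $J\subseteq I$, $\prod_{i\in J}A_i$ is identified with the subgroup of $A=\prod_{i\in I}A_i$ consisting of the elements $a=(a_i)_{i\in I}$ whose support $\{i\in I\mid a_i\neq e\}$ is contained in $J$. For a filter $\mathcal{U}$ on $I$, $A/\mathcal{U}$ denotes the reduced product: the quotient of $\prod_{i\in I} A_i$ by the equivalence relation $(a_i)\sim(b_i)$ iff $\{i\mid a_i=b_i\}\in\mathcal{U}$, with the induced group structure. A filter on $I$ is a set of subsets of $I$ containing $I$, closed under passing to larger subsets of $I$, and closed under pairwise intersections; it may be improper (equal to the set of all subsets of $I$). A filter is $\kappa$-complete if it is closed under intersections of families of $<\kappa$ members. An ultrafilter is a maximal proper filter; it is principal if it has the form $\{J\subseteq I\mid i_0\in J\}$ for some $i_0\in I$. An infinite cardinal $\mu$ is measurable if there exists a nonprincipal $\mu$-complete ultrafilter on $\mu$ (so $\aleph_0$ counts as measurable). The intersection of the empty family of ultrafilters is taken to be the set of all subsets of $I$; finite families may be empty ($n=0$), the empty product being the trivial group. A partition of $I$ is an expression of $I$ as the union of an indexed family of pairwise disjoint, possibly empty, subsets; ''into $<\kappa$ subsets'' means the index set $S$ has cardinality $<\kappa$. *)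

(* Defs.v *)
From HB Require Import structures.
From mathcomp Require Export all_boot.
From mathcomp Require Export boolp classical_sets functions cardinality filter.
From mathcomp Require Import generic_quotient.

Set Implicit Arguments.
Unset Strict Implicit.
Unset Printing Implicit Defensive.

(* MathComp with mathcomp-classical. Groups are the possibly infinite,
   multiplicatively written [groupType]s; as a map between groups that preserves
   products is a homomorphism, homomorphisms are [{multiplicative G -> H}]. *)

Open Scope card_scope.
Open Scope classical_set_scope.
Open Scope group_scope.
Local Open Scope quotient_scope.

Definition prodg (I : Type) (A : I -> groupType) : Type := forall i, A i.

Section ProductGroup.
Variables (I : Type) (A : I -> groupType).
Implicit Types a b c : prodg A.

HB.instance Definition _ := gen_eqMixin (prodg A).
HB.instance Definition _ := gen_choiceMixin (prodg A).

Definition prodg_one : prodg A := fun=> 1.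
Definition prodg_inv a : prodg A := fun i => (a i)^-1.
Definition prodg_mul a b : prodg A := fun i => a i * b i.

Fact prodg_mulA : associative prodg_mul.
Proof. by move=> a b c; apply: functional_extensionality_dep => i; apply: mulgA. Qed.
Fact prodg_mul1g : left_id prodg_one prodg_mul.
Proof. by move=> a; apply: functional_extensionality_dep => i; apply: mul1g. Qed.
Fact prodg_mulg1 : right_id prodg_one prodg_mul.
Proof. by move=> a; apply: functional_extensionality_dep => i; apply: mulg1. Qed.
Fact prodg_mulVg : left_inverse prodg_one prodg_inv prodg_mul.
Proof. by move=> a; apply: functional_extensionality_dep => i; apply: mulVg. Qed.
Fact prodg_mulgV : right_inverse prodg_one prodg_inv prodg_mul.
Proof. by move=> a; apply: functional_extensionality_dep => i; apply: mulgV. Qed.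

HB.instance Definition _ := isGroup.Build (prodg A)
  prodg_mulA prodg_mul1g prodg_mulg1 prodg_mulVg prodg_mulgV.

Definition supportg a : set I := [set i | a i <> 1].

(* The product of the [A i] over [i] in [J], as a subgroup of [prodg A]. *)
Definition subprod (J : set I) : set (prodg A) := [set a | supportg a `<=` J].

Definition proj_on (J : set I) (a : prodg A) : prodg (fun j : J => A (val j)) :=
  fun j => a (val j).

End ProductGroup.
Arguments subprod {I} A J.
Arguments proj_on {I} A J.

Section ReducedProduct.
Variables (I : Type) (A : I -> groupType) (F : filter_on I).
Implicit Types a b c : prodg A.

Definition eq_mod_filter a b : bool := `[< (F : set_system I) [set i | a i = b i] >].

Fact eq_mod_filter_refl : reflexive eq_mod_filter.
Proof.
by move=> a; apply/asboolP; apply: filterS filterT => i _ /=.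
Qed.
Fact eq_mod_filter_sym : symmetric eq_mod_filter.
Proof.
by move=> a b; apply/asboolP/asboolP; apply: filterS => i /= ->.
Qed.
Fact eq_mod_filter_trans : transitive eq_mod_filter.
Proof.
move=> b a c /asboolP Fab /asboolP Fbc; apply/asboolP.
by apply: filterS (filterI Fab Fbc) => i /= [-> ->].
Qed.

Canonical eq_mod_filter_equiv :=
  EquivRel eq_mod_filter eq_mod_filter_refl eq_mod_filter_sym eq_mod_filter_trans.

Definition reduced_prod : Type := {eq_quot eq_mod_filter}.
HB.instance Definition _ := Choice.on reduced_prod.
HB.instance Definition _ := EqQuotient.on reduced_prod.

Definition reduced_class : prodg A -> reduced_prod := \pi_reduced_prod.

Lemma reduced_classP a b :
  reduced_class a = reduced_class b <-> (F : set_system I) [set i | a i = b i].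
Proof.
split=> [/eqmodP/asboolP //|Fab]; by apply/eqmodP/asboolP.
Qed.

Definition reduced_one : reduced_prod := reduced_class 1.
Definition reduced_inv (x : reduced_prod) : reduced_prod :=
  reduced_class (repr x)^-1.
Definition reduced_mul (x y : reduced_prod) : reduced_prod :=
  reduced_class (repr x * repr y).

Lemma reduced_class_repr (x : reduced_prod) : reduced_class (repr x) = x.
Proof. exact: reprK. Qed.

Lemma reduced_classM a b :
  reduced_class (a * b) = reduced_mul (reduced_class a) (reduced_class b).
Proof.
apply/reduced_classP.
have /reduced_classP Fa := reduced_class_repr (reduced_class a).
have /reduced_classP Fb := reduced_class_repr (reduced_class b).
apply: filterS (filterI Fa Fb) => i /= [ea eb].
by congr (_ * _); rewrite ?ea ?eb.
Qed.

Lemma reduced_classV a :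
  reduced_class a^-1 = reduced_inv (reduced_class a).
Proof.
apply/reduced_classP.
have /reduced_classP Fa := reduced_class_repr (reduced_class a).
by apply: filterS Fa => i /= ea; congr (_^-1); rewrite ea.
Qed.

Fact reduced_mulA : associative reduced_mul.
Proof.
move=> x y z; rewrite -(reduced_class_repr x) -(reduced_class_repr y).
by rewrite -(reduced_class_repr z) -!reduced_classM mulgA.
Qed.
Fact reduced_mul1g : left_id reduced_one reduced_mul.
Proof.
by move=> x; rewrite -(reduced_class_repr x) -reduced_classM mul1g.
Qed.
Fact reduced_mulg1 : right_id reduced_one reduced_mul.
Proof.
by move=> x; rewrite -(reduced_class_repr x) -reduced_classM mulg1.
Qed.
Fact reduced_mulVg : left_inverse reduced_one reduced_inv reduced_mul.
Proof.
move=> x; rewrite -(reduced_class_repr x).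
by rewrite -reduced_classV -reduced_classM mulVg.
Qed.
Fact reduced_mulgV : right_inverse reduced_one reduced_inv reduced_mul.
Proof.
move=> x; rewrite -(reduced_class_repr x).
by rewrite -reduced_classV -reduced_classM mulgV.
Qed.

HB.instance Definition _ := isGroup.Build reduced_prod
  reduced_mulA reduced_mul1g reduced_mulg1 reduced_mulVg reduced_mulgV.
HB.instance Definition _ :=
  isMultiplicative.Build (prodg A) reduced_prod reduced_class reduced_classM.

End ReducedProduct.
Arguments reduced_prod {I} A F.
Arguments reduced_class {I A} F.

(* Cardinals are represented by types of that cardinality. *)
Definition card_lt (S T : Type) : Prop :=
  ([set: S] #<= [set: T]) /\ ~ ([set: T] #<= [set: S]).

Definition complete_filter (K T : Type) (F : set_system T) : Prop :=
  forall (S : Type) (G : S -> set T),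
    card_lt S K -> (forall s, F (G s)) -> F (\bigcap_s G s).

Definition principal (T : Type) (F : set_system T) : Prop :=
  exists x : T, F = principal_filter x.

(* The cardinality of the natural numbers counts as measurable. *)
Definition measurable_cardinal (M : Type) : Prop :=
  infinite_set [set: M] /\
  exists U : set_system M,
    [/\ UltraFilter U, ~ principal U & complete_filter M U].

Definition kerg (G H : groupType) (h : G -> H) : set G := [set x | h x = 1].

Definition factors_through (G H C : groupType) (h : G -> C) (p : G -> H) : Prop :=
  exists g : {multiplicative H -> C}, forall x, h x = g (p x).

Section Conditions.
Variables (I : Type) (A : I -> groupType) (C : groupType).
Variables (h : prodg A -> C) (K : Type).

Definition kills_partitions : Prop :=
  forall (S : Type) (J : S -> set I),
    card_lt S K -> trivIset [set: S] J -> \bigcup_s J s = [set: I] ->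
    exists (n : nat) (s : 'I_n -> S),
      subprod A (~` \bigcup_k J (s k)) `<=` kerg h.

Definition reduced_classes (n : nat) (U : 'I_n -> filter_on I) (a : prodg A) :
    prodg (fun k => reduced_prod A (U k)) :=
  fun k => reduced_class (U k) a.

Definition ultrafilter_factorization (n : nat) (U : 'I_n -> filter_on I) : Prop :=
  (forall k, UltraFilter (U k) /\ complete_filter K (U k)) /\
  factors_through h (reduced_classes U).

(* Families are compared through the sets of their members, and the least one
   is listed without repetition. *)
Definition least_ultrafilter_factorization (n : nat) (U : 'I_n -> filter_on I) :
    Prop :=
  [/\ ultrafilter_factorization U,
      injective (fun k => U k : set_system I) &
      forall (m : nat) (V : 'I_m -> filter_on I),
        ultrafilter_factorization V ->
        forall k, exists l, (U k : set_system I) = V l].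

Definition kernel_filter : set_system I :=
  [set J | subprod A (~` J) `<=` kerg h].

End Conditions.

(* Main.v *)
(* A map [h] kills the elements supported outside of [J] exactly when [h a] only
   depends on the restriction of [a] to [J]; hence such [J] form a filter [F], and
   (a) says that every partition of [I] into fewer than [K] sets has a finite
   subunion in [F]. As [K] is uncountable this applies to countable partitions, so
   the Boolean algebra of subsets of [I] modulo [F] has no infinite antichain, is
   finite, and [F] is the intersection of finitely many ultrafilters; each of them
   contains a piece of every partition into fewer than [K] sets, which is
   [K]-completeness. Distinct ultrafilters have disjoint members, so the map from
   the product to the finitely many ultraproducts is surjective, and [h] factors
   through it because [F] contains the intersection of the ultrafilters.

   A nonprincipal [K]-complete ultrafilter on [I] yields a measurable cardinal
   between [K] and [I]: take the least cardinality [M] of a family of members with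
   intersection outside of the ultrafilter, and push the ultrafilter forward along
   a map sending each point missing from the intersection to a member it avoids. *)
From HB Require Import structures.
Require Import Defs.

Set Implicit Arguments.
Unset Strict Implicit.
Unset Printing Implicit Defensive.

(** * Comparison of cardinalities *)

Lemma card_leTT_injP (S T : Type) :
  [set: S] #<= [set: T] <-> exists f : S -> T, injective f.
Proof.
split=> [/card_leP[f]|[f finj]].
  exists (fun x => val (f (to_setT x))) => x y /val_inj /(@inj _ _ _ f).
  by rewrite !in_setT => /(_ isT isT) [].
have /injfunPex[g] : exists2 f : S -> T, set_fun setT setT f & set_inj setT f.
  by exists f => // x y _ _; apply: finj.
exact: inj_card_le.
Qed.

(* A maximal set of choice functions on which all the projections are injective
   has a surjective projection; a section of it followed by the other projections
   gives the embeddings. *)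
Lemma least_card (J : Type) (X : J -> Type) (j0 : J) :
  exists j, forall k, [set: X j] #<= [set: X k].
Proof.
pose P (T : set (forall j, X j)) :=
  forall j x y, T x -> T y -> x j = y j -> x = y.
have [F FP Ftot|T [TP Tmax]] := @Zorn_bigcup _ P.
  move=> j x y [Y FY Yx] [Z FZ Zy]; have [YZ|ZY] := Ftot _ _ FY FZ.
    by apply: (FP _ FZ) => //; apply: YZ.
  by apply: (FP _ FY) => //; apply: ZY.
have [j surj_j] : exists j, forall u, exists2 x, T x & x j = u.
  (* If no projection is onto, choosing a missed value in each coordinate gives a function that can
     be added to [T]; [j0] shows that it is new. *)
  apply: contrapT => /forallNP nsurj.
  have new j : exists u, ~ exists2 x, T x & x j = u.
    by apply/existsNP; apply: nsurj.
  pose f j := sval (cid (new j)).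
  have Tf j x : T x -> x j <> f j.
    by move=> Tx xf; case: (svalP (cid (new j))); exists x.
  apply: (Tmax (T `|` [set f])).
    split=> [x Tx|sub]; first by left.
    by apply: (Tf j0 f) => //; apply: sub; right.
  move=> j x y [Tx|->] [Ty|->] // exy; first exact: TP exy.
    by case: (Tf j x).
  by case: (Tf j y).
exists j => k; apply/card_leTT_injP.
have /choice[g gP] : forall u, exists x, T x /\ x j = u.
  by move=> u; have [x] := surj_j u; exists x.
exists (fun u => g u k) => u v /= guv.
have [Tu <-] := gP u; have [Tv <-] := gP v.
by rewrite (TP k _ _ Tu Tv guv).
Qed.

Lemma card_le_total (S T : Type) :
  [set: S] #<= [set: T] \/ [set: T] #<= [set: S].
Proof.
have [[] H] := @least_card bool (fun b => if b then S else T) true.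
  by left; apply: (H false).
by right; apply: (H true).
Qed.

Lemma uncountable_infinite (K : Type) :
  ~ countable [set: K] -> infinite_set [set: K].
Proof. by apply: contra_not => /finite_set_countable. Qed.

Lemma card_lt_uncountable (S K : Type) :
  ~ countable [set: K] -> countable [set: S] -> card_lt S K.
Proof.
move=> Kunc Scnt; split; last by move=> /card_le_trans/(_ Scnt).
apply: card_le_trans Scnt _.
by apply/infiniteP/uncountable_infinite.
Qed.

(** * Ultrafilters and finite intersections of them *)

Section Ultrafilter.
Variables (T : Type) (U : set_system T).
Hypothesis UU : UltraFilter U.

Lemma ultraC (P : set T) : U (~` P) <-> ~ U P.
Proof.
split=> [UcP UP|]; last by have [] := in_ultra_setVsetC P UU.
by apply: (@filter_not_empty _ U _); rewrite -(setICr P); apply: filterI.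
Qed.

Lemma ultra_sub (V : set_system T) : UltraFilter V -> V `<=` U -> V = U.
Proof. by move=> VU VsubU; rewrite (@max_filter _ V _ U). Qed.

End Ultrafilter.

Lemma ultraP (T : Type) (U : set_system T) : ProperFilter U ->
  (forall P, U P \/ U (~` P)) -> UltraFilter U.
Proof.
move=> UU Uor; split=> // G GG UG; apply/seteqP; split=> // P GP.
have [//|/UG GcP] := Uor P.
by case: (@filter_not_empty _ G _); rewrite -(setICr P); apply: filterI.
Qed.

(* If the conclusion fails, there is a decreasing sequence of sets [X n] such that
   it fails for [within (X n) F] and [F] misses the complement of [X n `\` X n.+1]. *)
Lemma finite_ultrafilters (T : Type) (F : set_system T) : Filter F ->
  (forall J : nat -> set T, trivIset [set: nat] J -> exists n, F (~` J n)) ->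
  exists s : seq (set_system T),
    (forall U, U \in s -> UltraFilter U) /\
    forall P, F P <-> forall U, U \in s -> U P.
Proof.
move=> FF Fdisj.
pose good X := exists s : seq (set_system T),
    (forall U, U \in s -> UltraFilter U) /\
    forall P, within X F P <-> forall U, U \in s -> U P.
suff [s [sU sP]] : good setT.
  by exists s; split=> // P; rewrite -sP withinET.
apply: contrapT => badT.
have split_bad X : ~ good X -> exists Y, [/\ Y `<=` X, ~ good Y &
    ~ F (~` (X `\` Y))].
  move=> badX; apply: contrapT => /forallNP nsplit.
  have XN0 : ~ F (~` X).
    move=> FcX; apply: badX; exists [::]; split=> // P; split=> // _.
    by apply: (@filterS _ F) FcX => x nX /nX.
  (* If neither [Y] nor its complement in [X] is negligible modulo [F], both are good, and their
     lists concatenate to one for [X]. *)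
  have half Y : Y `<=` X -> F (~` Y) \/ F (~` (X `\` Y)).
    move=> YX; apply: contrapT => /not_orP [FY FXY]; apply: badX.
    have [s [sU sP]] : good Y.
      by apply: contrapT => badY; apply: (nsplit Y); split.
    have [t [tU tP]] : good (X `\` Y).
      apply: contrapT => badXY; apply: (nsplit (X `\` Y)); split=> //.
      by rewrite setDD setIidr.
    exists (s ++ t); split=> [U|P]; first by rewrite mem_cat => /orP[/sU|/tU].
    split=> [FP U|stP].
      have sub Z : Z `<=` X -> within Z F P.
        by move=> ZX; apply: (@filterS _ F) FP => x XP /ZX.
      by rewrite mem_cat => /orP[]; move: U; [apply/sP|apply/tP]; apply: sub.
    have F1 : within Y F P by apply/sP => U Us; apply: stP; rewrite mem_cat Us.
    have F2 : within (X `\` Y) F P.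
      by apply/tP => U Us; apply: stP; rewrite mem_cat Us orbT.
    apply: (@filterS2 _ F) F1 F2 => x YP XYP Xx.
    by have [/YP//|nY] := pselect (Y x); apply: XYP.
  (* By [XN0] and [half], [within X F] is itself an ultrafilter. *)
  apply: badX; exists [:: within X F]; split=> [U|P].
    rewrite inE => /eqP ->; apply: ultraP.
      split=> [F0|]; last exact: within_filter.
      by apply: XN0; apply: (@filterS _ F) F0 => x.
    move=> P; have [|F1|F1] := half (P `&` X); first by move=> x [].
      by right; apply: (@filterS _ F) F1 => x nPX Xx Px; apply: nPX.
    left; apply: (@filterS _ F) F1 => x nx Xx.
    by apply: contrapT => nP; apply: nx; split=> // -[].
  split=> [FP U|]; first by rewrite inE => /eqP ->.
  by apply; rewrite inE.
pose B := {X | ~ good X}.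
have /choice[next nextP] : forall X : B, exists Y : B,
    sval Y `<=` sval X /\ ~ F (~` (sval X `\` sval Y)).
  move=> [X badX]; have [Y [YX badY FY]] := split_bad X badX.
  by exists (exist _ Y badY).
pose X n := sval (iter n next (exist _ setT badT)).
have XS m n : (m <= n)%N -> X n `<=` X m.
  move=> /subnK <-; elim: (n - m)%N => [//|k IH]; apply: subset_trans IH.
  by case: (nextP (iter (k + m) next (exist _ setT badT))).
have [|n Fn] := Fdisj (fun n => X n `\` X n.+1).
  apply/trivIsetP => i j _ _ ij; apply/seteqP; split=> // x [[Xi nXi] [Xj nXj]].
  have [/XS/(_ _ Xj)//|ji|] := ltngtP i j; last by move/eqP: ij.
  by apply: nXj; apply: (XS j.+1 i ji).
by case: (nextP (iter n next (exist _ setT badT))).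
Qed.

Lemma ultra_bigcup (T : Type) (U : set_system T) (J : finType) (P : J -> set T) :
  UltraFilter U -> U (\bigcup_j P j) -> exists j, U (P j).
Proof.
move=> UU UP; apply: contrapT => /forallNP nP.
have: U [set x | forall j, ~ P j x] by apply: filter_forall => j; apply/ultraC.
by move=> /(filterI UP)/filter_ex[x [[j _ Pjx] /(_ j)]].
Qed.

(** Otherwise each [V j] has a member outside [U]. The union of these lies in every [V j], hence in
    [U], so one of them is in [U] after all. *)
Lemma ultra_sub_family (T : Type) (U : set_system T) (J : finType)
    (V : J -> set_system T) : UltraFilter U -> (forall j, UltraFilter (V j)) ->
  \bigcap_j V j `<=` U -> exists j, U = V j.
Proof.
move=> UU VU VsubU; apply: contrapT => /forallNP neq.
have /choice[B BP] : forall j, exists B, V j B /\ ~ U B.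
  move=> j; apply: contrapT => /forallNP sub; apply: (neq j); symmetry.
  apply: ultra_sub => // B VB.
  by apply: contrapT => UB; apply: (sub B).
have [|j] := @ultra_bigcup _ U _ B UU; last by case: (BP j).
by apply: VsubU => j _; apply: filterS (BP j).1 => x; exists j.
Qed.

(** Separate each ordered pair by a set in the first ultrafilter but not in the second, then
    intersect the finitely many conditions on each index. *)
Lemma ultra_separated (T : Type) (J : finType) (U : J -> set_system T) :
  (forall j, UltraFilter (U j)) -> injective U ->
  exists D : J -> set T, (forall j, U j (D j)) /\ trivIset [set: J] D.
Proof.
move=> UU Uinj.
have /choice[B BP] : forall p : J * J, exists B,
    p.1 <> p.2 -> U p.1 B /\ ~ U p.2 B.
  move=> [j k] /=; apply: contrapT => /forallNP noB.
  have jk : j <> k by move=> ejk; apply: (noB setT).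
  apply: jk; apply: Uinj; apply: ultra_sub => // B UB.
  by apply: contrapT => nUB; apply: (noB B).
exists (fun j => [set x | forall k, j <> k -> B (j, k) x /\ ~ B (k, j) x]).
split=> [j|]; last first.
  apply/trivIsetP => j k _ _ /eqP jk; apply/seteqP; split=> // x [Dj Dk].
  by have [Bx _] := Dj k jk; have [_] := Dk j (nesym jk).
apply: filter_forall => k; have [<-|jk] := pselect (j = k).
  exact: filterE.
have [/= UB _] := BP (j, k) jk; have [/= _ nUB] := BP (k, j) (nesym jk).
by apply: (@filterS2 _ (U j)) UB ((ultraC _ _).2 nUB).
Qed.

(** * Completeness from finitely many fibres *)

(* Partitions into fewer than [K] sets are presented as the fibres of a function
   with values in a type of cardinality less than [K]. *)
Definition finitely_many_fibres (K T : Type) (F : set_system T) : Prop :=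
  forall (S : Type) (f : T -> S), card_lt S K ->
  exists (n : nat) (s : 'I_n -> S), F (\bigcup_k f @^-1` [set s k]).

(** Send a point to the index of its piece, or to 0 off all pieces. Finitely many fibres have
    bounded indices, so the piece just past the bound misses their union. *)
Lemma finite_fibres_disjoint (K T : Type) (F : set_system T) (J : nat -> set T) :
  Filter F -> ~ countable [set: K] -> finitely_many_fibres K F ->
  trivIset [set: nat] J -> exists n, F (~` J n).
Proof.
move=> FF Kunc Ffib /trivIsetP Jtriv.
have /choice[f fP] : forall x, exists n, forall m, J m x -> n = m.
  move=> x; have [[n Jn]|/forallNP nJ] := pselect (exists n, J n x).
    exists n => m Jm; apply/eqP; apply: contrapT => /negP/(Jtriv n m I I) nm.
    by suff: set0 x by []; rewrite -nm.
  by exists 0%N => m /nJ.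
have [|n [s Fs]] := Ffib nat f; first exact: card_lt_uncountable.
exists (\max_k s k).+1; apply: filterS Fs => x [k _ /= fk] /fP fm.
by have := leq_bigmax (F := s) k; rewrite -fk fm ltnn.
Qed.

(** Were the intersection outside [U], sending each point missing from it to a member avoided would
    give a fibre in [U] that avoids, off the intersection, a member of [U]. *)
Lemma ultra_finite_fibres_complete (K T : Type) (F U : set_system T) :
  finitely_many_fibres K F -> F `<=` U -> UltraFilter U -> complete_filter K U.
Proof.
move=> Ffib FU UU S G SK UG; apply: contrapT => nUG.
have nUG' : U (~` \bigcap_s G s) by apply/ultraC.
have [y ny] := filter_ex nUG'.
have [s0 _] : exists s0, ~ G s0 y by apply/existsNP => Gy; apply: ny => s _.
have /choice[f fP] : forall x, exists s, (~` \bigcap_s G s) x -> ~ G s x.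
  move=> x; have [Gx|/existsNP[s nGs]] := pselect (forall s, G s x).
    by exists s0; case=> s _.
  by exists s.
have [n [s /FU/ultra_bigcup[k Uk]]] := Ffib S f SK.
have [x [[fx nx] Gx]] := filter_ex (filterI (filterI Uk nUG') (UG (s k))).
by case: (fP x nx); rewrite (fx : f x = s k).
Qed.

Lemma complete_ultra_cover (K T S : Type) (U : set_system T) (J : S -> set T) :
  UltraFilter U -> complete_filter K U -> card_lt S K ->
  \bigcup_s J s = [set: T] -> exists s, U (J s).
Proof.
move=> UU UK SK Jcov; apply: contrapT => /forallNP nJ.
have /(UK _ _ SK)/filter_ex[x nJx] : forall s, U (~` J s).
  by move=> s; apply/ultraC.
have : [set: T] x by [].
by rewrite -Jcov => -[s _ Js]; apply: (nJx s).
Qed.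

(** * Measurable cardinals from nonprincipal ultrafilters *)

Lemma nonprincipal_measurable (I K : Type) (U : set_system I) :
  infinite_set [set: K] -> UltraFilter U -> complete_filter K U ->
  ~ principal U ->
  exists M : Type, [/\ measurable_cardinal M, [set: K] #<= [set: M] &
                       [set: M] #<= [set: I]].
Proof.
move=> Kinf UU UK Uprinc.
(* Indexing families by subsets of [I] lets [least_card] range over them. *)
pose bad (Y : set I) := exists G : I -> set I,
  (forall i, Y i -> U (G i)) /\ ~ U (\bigcap_(i in Y) G i).
have bad_range (S : Type) (e : S -> I) (G : S -> set I) : injective e ->
    (forall s, U (G s)) -> ~ U (\bigcap_s G s) -> bad (range e).
  move=> einj UG nUG; exists (fun i => [set x | forall s, e s = i -> G s x]).
  split=> [_ [s _ <-]|]; first by apply: filterS (UG s) => x Gx t /einj ->.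
  apply: contra_not nUG; apply: filterS => x Gx s _.
  by apply: (Gx (e s)) => //; exists s.
have badT : bad (range (@id I)).
  apply: (bad_range _ _ (fun i => ~` [set i])) => // [i|].
    apply/ultraC => Ui; apply: Uprinc; exists i.
    symmetry; apply: ultra_sub => //; first exact: principal_filter_ultra.
    by move=> P /principal_filterP Pi; apply: filterS Ui => _ ->.
  by move=> /filter_ex[x /(_ x)]; apply.
pose X (Y : {Y | bad Y}) := {i | sval Y i}.
have [[Y badY] Ymin] := @least_card _ X (exist _ _ badT).
pose M := X (exist _ Y badY); have [G [UG nUG]] := badY.
have X_inj Z : injective (fun m : X Z => sval m).
  by move=> [i Zi] [j Zj] /= ij; subst j; rewrite (Prop_irrelevance Zi Zj).
have MI : [set: M] #<= [set: I].
  by apply/card_leTT_injP; exists (fun m => sval m); apply: X_inj.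
have KM : [set: K] #<= [set: M].
  have [//|MK] := card_le_total K M; apply: contrapT => nKM; apply: nUG.
  have := UK M (fun m => G (sval m)) (conj MK nKM) (fun m => UG _ (svalP m)).
  by apply: filterS => x Gx i Yi; apply: (Gx (exist _ i Yi)).
(* As [M] embeds in [I], a smaller family with intersection outside [U] could be indexed by a bad
   subset of [I], against minimality. *)
have UM : complete_filter M U.
  move=> S H [SM nMS] UH; apply: contrapT => nUH; apply: nMS.
  have [e einj] := (card_leTT_injP _ _).1 (card_le_trans SM MI).
  have badS := bad_range S e H einj UH nUH.
  apply: card_le_trans (Ymin (exist _ _ badS)) _.
  apply/card_leTT_injP.
  have /choice[g gP] : forall i : X (exist _ _ badS), exists s, e s = sval i.
    by move=> i; have [s _ es] := svalP i; exists s.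
  by exists g => i j gij; apply: X_inj; rewrite -!gP gij.
have Minf : infinite_set [set: M].
  by apply/infiniteP; apply: card_le_trans KM; apply/infiniteP.
have [m0 _] := infinite_setN0 Minf.
have nG' : U (~` \bigcap_(i in Y) G i) by apply/ultraC.
have /choice[f fP] : forall x, exists m : M,
    (~` \bigcap_(i in Y) G i) x -> ~ G (sval m) x.
  move=> x; have [[m nGm]|/forallNP Gx] := pselect (exists m : M, ~ G (sval m) x).
    by exists m.
  exists m0; case=> i Yi; apply: contrapT => nGi.
  by apply: (Gx (exist _ i Yi)).
exists M; split=> //; split=> //.
exists (f @ U); split.
- by apply: ultraP => P; apply: (in_ultra_setVsetC (f @^-1` P)).
(* Off the intersection, the fibre of [m] avoids a member of [U], so it cannot be in [U]. *)
- move=> [m fUm].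
  have Um : U (f @^-1` [set m]).
    by rewrite -[U _]/((f @ U) [set m]) fUm; apply/principal_filterP.
  have [x [[/= fx nx] Gx]] := filter_ex (filterI (filterI Um nG') (UG _ (svalP m))).
  by case: (fP x nx); rewrite fx.
- by move=> S H SM UH; apply: (UM S (fun s => f @^-1` H s) SM).
Qed.

(** * Factoring homomorphisms and the kernel filter *)

Lemma surjective_factors_through (G H C : groupType)
    (h : {multiplicative G -> C}) (p : G -> H) :
  {morph p : x y / x * y} -> (forall y, exists x, p x = y) ->
  (forall x y, p x = p y -> h x = h y) -> factors_through h p.
Proof.
move=> pM /choice[r rK] ph.
have hr x : h (r (p x)) = h x by apply: ph; rewrite rK.
have gM : {morph h \o r : x y / x * y}.
  by move=> x y /=; rewrite -gmulfM; apply: ph; rewrite pM !rK.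
pose gm := isMultiplicative.Build H C (h \o r) gM.
by exists (HB.pack_for {multiplicative H -> C} (h \o r) gm) => x; rewrite /= hr.
Qed.

Section KernelFilter.
Variables (I : Type) (A : I -> groupType) (C : groupType).
Variable h : {multiplicative prodg A -> C}.

Lemma kernel_filterP (J : set I) :
  kernel_filter h J <->
    forall a b : prodg A, (forall i, J i -> a i = b i) -> h a = h b.
Proof.
split=> [kJ a b ab|hJ a aJ].
  rewrite -(mulgVK b a) gmulfM (_ : h (a * b^-1) = 1) ?mul1g //.
  apply: kJ => i /= + Ji; apply; rewrite -[LHS]/(a i * (b i)^-1).
  by rewrite ab // mulgV.
have h1 : h 1 = 1 by apply: (mulIg (h 1)); rewrite -gmulfM !mul1g.
rewrite /kerg /= -h1; apply: hJ => i Ji; apply: contrapT => ai; exact: (aJ i ai).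
Qed.

Lemma kernel_filter_filter : Filter (kernel_filter h).
Proof.
split.
- apply/kernel_filterP => a b ab; congr (h _).
  by apply: functional_extensionality_dep => i; apply: ab.
- move=> P Q /kernel_filterP hP /kernel_filterP hQ; apply/kernel_filterP.
  (* [c] agrees with [a] on [P] and with [b] on [Q]. *)
  move=> a b ab; pose c : prodg A := fun i => if `[< P i >] then a i else b i.
  rewrite (hP a c) => [|i Pi]; last by rewrite /c asboolT.
  by apply: hQ => i Qi; rewrite /c; case: asboolP => // Pi; apply: ab.
- move=> P Q PQ /kernel_filterP hP; apply/kernel_filterP => a b ab.
  by apply: hP => i /PQ; apply: ab.
Qed.

Lemma kills_partitions_fibres (K : Type) :
  kills_partitions h K -> finitely_many_fibres K (kernel_filter h).
Proof.
move=> kills S f SK; apply: (kills S (fun s => f @^-1` [set s]) SK).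
  by move=> s t _ _ [x [/= <- <-]].
by apply/seteqP; split=> // x _; exists (f x).
Qed.

Lemma factorization_kernel (n : nat) (U : 'I_n -> filter_on I) :
  factors_through h (reduced_classes U) ->
  \bigcap_k (U k : set_system I) `<=` kernel_filter h.
Proof.
move=> [g hg] J UJ; apply/kernel_filterP => a b ab; rewrite !hg; congr (g _).
apply: functional_extensionality_dep => k; apply/reduced_classP.
by apply: filterS ab (UJ k _).
Qed.

(* Disjoint members of distinct ultrafilters make the product of the quotient
   maps surjective. *)
Lemma kernel_factorization (n : nat) (U : 'I_n -> filter_on I) :
  (forall k, UltraFilter (U k)) -> injective (fun k => U k : set_system I) ->
  \bigcap_k (U k : set_system I) `<=` kernel_filter h ->
  factors_through h (reduced_classes U).
Proof.
move=> UU Uinj Uker; apply: surjective_factors_through => [a b|x|a b ab].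
- apply: functional_extensionality_dep => k; exact: reduced_classM.
- have [D [UD Dtriv]] := ultra_separated UU Uinj.
  have xD i : exists c : A i, forall k, D k i -> repr (x k) i = c.
    have [[k Dk]|/forallNP nD] := pselect (exists k, D k i); last first.
      by exists 1 => k /nD.
    exists (repr (x k) i) => l Dl; suff -> : l = k by [].
    by apply: Dtriv => //; exists i.
  exists (fun i => sval (cid (xD i))); apply: functional_extensionality_dep => k.
  rewrite -[RHS]reduced_class_repr; apply/reduced_classP.
  by apply: filterS (UD k) => i Dk /=; case: cid => c /(_ k Dk) /=.
- suff /kernel_filterP/(_ a b) : kernel_filter h [set i | a i = b i] by apply.
  by apply: Uker => k _; apply/reduced_classP; move: (congr1 (@^~ k) ab).
Qed.
End KernelFilter.

(** * Equivalence, least family and small index sets *)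

Section Conditions.
Variables (I : Type) (A : I -> groupType) (C : groupType).
Variables (h : {multiplicative prodg A -> C}) (K : Type).

Lemma factorization_kills_partitions (n : nat) (U : 'I_n -> filter_on I) :
  ultrafilter_factorization h K U -> kills_partitions h K.
Proof.
move=> [UU /factorization_kernel Uker] S J SK _ Jcov.
have /choice[s sP] : forall k, exists s, (U k : set_system I) (J s).
  by move=> k; have [Uk UkK] := UU k; apply: complete_ultra_cover UkK SK Jcov.
exists n, s; apply: Uker => k _; apply: filterS (sP k) => i; exists k => //.
Qed.

Hypothesis K_uncountable : ~ countable [set: K].

Lemma kills_partitions_least : kills_partitions h K ->
  exists (n : nat) (U : 'I_n -> filter_on I),
    least_ultrafilter_factorization h K U /\
    kernel_filter h = \bigcap_k (U k : set_system I).
Proof.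
move=> /kills_partitions_fibres kills.
have FF := kernel_filter_filter h.
have [s [sU sP]] := finite_ultrafilters FF
  (fun J => finite_fibres_disjoint (J := J) FF K_uncountable kills).
(* Removing repetitions makes [U] injective, as both leastness and [kernel_factorization] demand. *)
pose t := undup s; have tU k : UltraFilter (tnth (in_tuple t) k).
  by apply: sU; rewrite -mem_undup; apply: (mem_tnth k (in_tuple t)).
pose U k := FilterType (tnth (in_tuple t) k) (@ultra_proper _ _ (tU k)).
have kerU : kernel_filter h = \bigcap_k (U k : set_system I).
  apply/seteqP; split=> [P /sP FP k _|P UP].
    by apply: FP; rewrite -mem_undup; apply: (mem_tnth k (in_tuple t)).
  apply/sP => V; rewrite -mem_undup => /(tnthP (in_tuple t))[k ->].
  exact: (UP k).
have Uinj : injective (fun k => U k : set_system I).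
  by apply/(tuple_uniqP (in_tuple t)); apply: undup_uniq.
exists (size t), U; split=> //; split=> //.
  split=> [k|]; last by apply: kernel_factorization => //; rewrite kerU.
  split; first exact: tU.
  apply: ultra_finite_fibres_complete kills _ (tU k).
  by rewrite kerU => P; apply.
(* The intersection of the [V l] lies in the kernel filter, hence in [U k], so [U k] is one of
   them. *)
move=> m V [VU /factorization_kernel Vker] k.
apply: ultra_sub_family => [|P VP].
  by move=> j; case: (VU j).
by move: (Vker P VP); rewrite kerU; apply.
Qed.

Lemma principal_factorization (n : nat) (U : 'I_n -> filter_on I) :
  \bigcap_k (U k : set_system I) `<=` kernel_filter h ->
  (forall k, principal (U k)) ->
  exists J : set I, finite_set J /\ factors_through h (proj_on A J).
Proof.
(* The finitely many generating points form a set in every [U k]. *)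
move=> Uker /choice[i iP]; exists (range i); split.
  exact/finite_image/finite_finset.
have kerJ : kernel_filter h (range i).
  by apply: Uker => k _; rewrite iP; apply/principal_filterP; exists k.
apply: surjective_factors_through => // [y|a b ab].
  have yJ j : exists c : A j, forall Jj : j \in range i, y (exist _ j Jj) = c.
    have [Jj|nJj] := pselect (j \in range i).
      by exists (y (exist _ j Jj)) => Jj'; rewrite (bool_irrelevance Jj' Jj).
    by exists 1 => Jj; case: (nJj Jj).
  exists (fun j => sval (cid (yJ j))); apply: functional_extensionality_dep.
  by case=> j Jj; rewrite /proj_on /=; case: cid => c /= ->.
move/kernel_filterP: kerJ; apply=> j Jj.
exact: (congr1 (@^~ (exist _ j (mem_set Jj))) ab).
Qed.
End Conditions.

Theorem corollary7 (I : Type) (A : I -> groupType) (C : groupType)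
    (h : {multiplicative prodg A -> C})
    (K : Type) (K_uncountable : ~ countable [set: K]) :
  (kills_partitions h K <->
     exists (n : nat) (U : 'I_n -> filter_on I), ultrafilter_factorization h K U) /\
  (kills_partitions h K ->
     ((forall M : Type,
         measurable_cardinal M -> [set: K] #<= [set: M] -> card_lt I M) ->
      exists J : set I, finite_set J /\ factors_through h (proj_on A J)) /\
     (Filter (kernel_filter h) /\
      exists (n : nat) (U : 'I_n -> filter_on I),
        least_ultrafilter_factorization h K U /\
        kernel_filter h = \bigcap_k (U k : set_system I))).
Proof.
have least := kills_partitions_least (h := h) K_uncountable.
split.
  split=> [/least[n [U [[UU _ _] _]]]|[n [U UU]]]; first by exists n, U.
  exact: factorization_kills_partitions UU.
move=> kills; split=> [small|]; last first.
  by split; [exact: kernel_filter_filter|exact: least].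
have [n [U [[[UU _] _ _] kerU]]] := least kills.
apply: (@principal_factorization _ _ _ _ n U) => [|k]; first by rewrite kerU.
have [Uk UkK] := UU k; apply: contrapT => nprinc.
have [M [Mmeas KM MI]] :=
  nonprincipal_measurable (uncountable_infinite K_uncountable) Uk UkK nprinc.
by have [_] := small M Mmeas KM.
Qed.
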